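(* Let $c_1,c_2$ be real numbers with $c_2>c_1>0$ (network capacities), let $d_A,d_B>0$ (demands) satisfy $D:=d_A+d_B<c_1+c_2$, and let $\alpha_A>\alpha_B>0$ (tax sensitivities). Let the delay functions be $\ell_p(x)=(c_p-x)^{-1}$ if $x<c_p$ and $\ell_p(x)=\infty$ if $x\ge c_p$, for $p=1,2$. Let $f^{\mathrm{opt}}=(f_1^{\mathrm{opt}},f_2^{\mathrm{opt}})$ be the (unique) minimizer of the total delay $C(f)=f_1\ell_1(f_1)+f_2\ell_2(f_2)$ over all $f=(f_1,f_2)$ with $f_1,f_2\ge 0$ and $f_1+f_2=D$. If $D>c_2-\sqrt{c_1c_2}$, then an optimal tax to apply to network $2$ (network $1$ being untaxed, $\tau_1=0$) is $$\tau_2=\begin{cases}\dfrac{c_2-c_1}{\alpha_A\sqrt{c_1c_2}\,(c_2+c_1-D)} & \text{if } d_B\le f_2^{\mathrm{opt}},\\[3mm] \dfrac{c_2-c_1}{\alpha_B\sqrt{c_1c_2}\,(c_2+c_1-D)} & \text{otherwise,}\end{cases}$$ that is, with taxes $(0,\tau_2)$ the Wardrop equilibrium among users has total network flows equal to $f^{\mathrm{opt}}$. If $D\le c_2-\sqrt{c_1c_2}$, then no tax is necessary, that is, with taxes $(0,0)$ the Wardrop equilibrium among users has total network flows equal to $f^{\mathrm{opt}}$.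
   Context: There are two parallel networks $p\in\{1,2\}$ and two classes of non-atomic users $i\in\{A,B\}$ with inelastic demands $d_A,d_B$. A feasible flow repartition consists of reals $f_{p,i}\ge 0$ with $f_{1,i}+f_{2,i}=d_i$ for $i\in\{A,B\}$; the total flow on network $p$ is $f_p=f_{p,A}+f_{p,B}$. Given taxes $\tau_1,\tau_2$, the cost perceived by a class-$i$ user on network $p$ is $\ell_p(f_p)+\alpha_i\tau_p$ (with values in $(-\infty,+\infty]$). Wardrop equilibrium (for taxes $\tau_1,\tau_2$): a feasible flow repartition $(\bar f_{p,i})$, with totals $\bar f_p=\bar f_{p,A}+\bar f_{p,B}$, such that whenever $\bar f_{p,i}>0$ for some $p\in\{1,2\}$ and $i\in\{A,B\}$, one has $\ell_p(\bar f_p)+\alpha_i\tau_p\le \ell_{p'}(\bar f_{p'})+\alpha_i\tau_{p'}$, where $p'\ne p$ is the other network. A tax $\tau_2$ on network $2$ (with $\tau_1=0$) is called optimal if the Wardrop equilibrium for taxes $(0,\tau_2)$ satisfies $\bar f_{1,A}+\bar f_{1,B}=f_1^{\mathrm{opt}}$ and $\bar f_{2,A}+\bar f_{2,B}=f_2^{\mathrm{opt}}$. Here ''the Wardrop equilibrium has total flows $f^{\mathrm{opt}}$'' means that a Wardrop equilibrium exists and every Wardrop equilibrium has these total flows. *)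

(* Defs.v *)
From mathcomp Require Import all_boot all_order all_algebra.
From mathcomp Require Import boolp reals ereal.

Set Implicit Arguments.
Unset Strict Implicit.
Unset Printing Implicit Defensive.

Import Order.TTheory GRing.Theory Num.Theory.
Local Open Scope ring_scope.

Inductive network := Net1 | Net2.

Inductive user_class := ClassA | ClassB.

Definition other (p : network) : network :=
  match p with Net1 => Net2 | Net2 => Net1 end.

Definition delay (R : realType) (c : network -> R) (p : network) (x : R)
    : \bar R :=
  if x < c p then ((c p - x)^-1)%:E else +oo%E.

Definition feasible_totals (R : realType) (D : R) (g : network -> R) : Prop :=
  (forall p, 0 <= g p) /\ g Net1 + g Net2 = D.

(* In [\bar R], [0 * +oo = 0]; with positive capacities this product does not
   occur here, because [delay c p 0 = (c p)^-1] is finite. *)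
Definition total_delay (R : realType) (ell : network -> R -> \bar R)
    (g : network -> R) : \bar R :=
  ((g Net1)%:E * ell Net1 (g Net1) + (g Net2)%:E * ell Net2 (g Net2))%E.

Definition min_total_delay (R : realType) (ell : network -> R -> \bar R)
    (D : R) (g : network -> R) : Prop :=
  feasible_totals D g /\
  forall h, feasible_totals D h -> (total_delay ell g <= total_delay ell h)%E.

Definition feasible_flow (R : realType) (d : user_class -> R)
    (f : network -> user_class -> R) : Prop :=
  (forall p i, 0 <= f p i) /\ (forall i, f Net1 i + f Net2 i = d i).

Definition total_flow (R : realType) (f : network -> user_class -> R)
    (p : network) : R := f p ClassA + f p ClassB.

Definition user_cost (R : realType) (ell : network -> R -> \bar R)
    (alpha : user_class -> R) (tau : network -> R)
    (f : network -> user_class -> R) (p : network) (i : user_class) : \bar R :=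
  (ell p (total_flow f p) + (alpha i * tau p)%:E)%E.

Definition wardrop_equilibrium (R : realType) (ell : network -> R -> \bar R)
    (d alpha : user_class -> R) (tau : network -> R)
    (f : network -> user_class -> R) : Prop :=
  feasible_flow d f /\
  forall p i, 0 < f p i ->
    (user_cost ell alpha tau f p i <= user_cost ell alpha tau f (other p) i)%E.

Definition tax_on_net2 (R : realType) (tau2 : R) (p : network) : R :=
  match p with Net1 => 0 | Net2 => tau2 end.

(* Wardrop equilibria need not be unique as class-wise flows: "the" equilibrium
   having given totals means that one exists and that all of them have these
   totals. *)
Definition optimal_tax (R : realType) (ell : network -> R -> \bar R)
    (d alpha : user_class -> R) (fopt : network -> R) (tau2 : R) : Prop :=
  (exists f, wardrop_equilibrium ell d alpha (tax_on_net2 tau2) f) /\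
  (forall f, wardrop_equilibrium ell d alpha (tax_on_net2 tau2) f ->
     forall p, total_flow f p = fopt p).

(* Main.v *)
(* Delays are strictly increasing, so two equilibria for the same taxes have the
   same totals; hence it suffices to exhibit one equilibrium with totals the
   optimum.  By convexity the optimum is given by the first-order condition: it
   is an interior stationary point when [c2 - sqrt (c1 c2) < D], and [(0, D)]
   otherwise.  In the interior case network 1 is slower than network 2 at the
   optimum by exactly [(c2 - c1) / (sqrt (c1 c2) (c1 + c2 - D))].  The tax makes
   one class indifferent at this difference; the more sensitive class A is
   steered to network 1, the less sensitive class B to network 2, and whether
   [d_B] fits in the optimal flow on network 2 decides which of them splits. *)

Require Import Defs.
From mathcomp Require Import all_boot all_order all_algebra.
From mathcomp Require Import boolp reals ereal.
From mathcomp Require Import ring lra.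

Import Order.TTheory GRing.Theory Num.Theory.
Local Open Scope ring_scope.

(** * Uniqueness of equilibrium totals *)

Section Delay.
Variables (R : realType) (c : network -> R).

Lemma delayE p x : x < c p -> delay c p x = ((c p - x)^-1)%:E.
Proof. by rewrite /delay => ->. Qed.

Lemma delay_gt p x y : x < c p -> x < y -> (delay c p x < delay c p y)%E.
Proof.
move=> xc xy; rewrite (delayE _ _ xc) /delay; case: ifP => yc; last exact: ltry.
by rewrite lte_fin ltf_pV2 ?posrE ?subr_gt0// ltrD2l ltrN2.
Qed.

(* If [G p > F p] then some class has users on [p] under [g] and on the other
   network under [f]; its two equilibrium inequalities contradict the
   monotonicity of the delays. *)
Lemma wardrop_total_le (d alpha : user_class -> R) (tau : network -> R) f g :
  (forall p, total_flow f p < c p) ->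
  wardrop_equilibrium (delay c) d alpha tau f ->
  wardrop_equilibrium (delay c) d alpha tau g ->
  forall p, total_flow g p <= total_flow f p.
Proof.
move=> fc [[f0 fd] fW] [[g0 gd] gW] p; rewrite leNgt; apply/negP => ltfg.
have sumE h i : h Net1 i + h Net2 i = d i -> h p i + h (other p) i = d i.
  by case: p {ltfg} => //=; rewrite addrC.
have fE i := sumE f i (fd i); have gE i := sumE g i (gd i).
have ltgf : total_flow g (other p) < total_flow f (other p).
  move: ltfg (fE ClassA) (fE ClassB) (gE ClassA) (gE ClassB).
  rewrite /total_flow; lra.
have [i ltfgi] : exists i, f p i < g p i.
  have [?|geA] := ltP (f p ClassA) (g p ClassA); first by exists ClassA.
  by exists ClassB; move: ltfg; rewrite /total_flow; lra.
have gp : 0 < g p i by exact: le_lt_trans ltfgi.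
have fp : 0 < f (other p) i by move: (fE i) (gE i) (g0 (other p) i); lra.
have := fW _ _ fp; have := gW _ _ gp; rewrite /user_cost.
have -> : other (other p) = p by case: (p).
have := delay_gt _ _ _ (fc p) ltfg.
have := delay_gt _ _ _ (lt_trans ltgf (fc _)) ltgf.
rewrite (delayE _ _ (fc p)) (delayE _ _ (fc (other p))).
(* Were [p] overloaded under [g], its users would bear cost [+oo] against a finite alternative. *)
rewrite (delayE _ _ (lt_trans ltgf (fc _))) /delay; case: ifP => // _.
by rewrite -!EFinD !lte_fin !lee_fin; lra.
Qed.

(** Another equilibrium has totals at most those of [f] on both networks; both pairs sum to the
    total demand, so they agree. *)
Lemma optimal_tax_of_equilibrium (d alpha : user_class -> R) fopt tau2 f :
  (forall p, total_flow f p = fopt p) -> (forall p, fopt p < c p) ->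
  wardrop_equilibrium (delay c) d alpha (tax_on_net2 tau2) f ->
  optimal_tax (delay c) d alpha fopt tau2.
Proof.
move=> ffopt foptc fW; split=> [|g gW p]; first by exists f.
have fc q : total_flow f q < c q by rewrite ffopt.
have gf := wardrop_total_le _ _ _ _ _ fc fW gW.
have [[_ fd] _] := fW; have [[_ gd] _] := gW.
have := gf Net1; have := gf Net2; rewrite -ffopt /total_flow.
move: (fd ClassA) (fd ClassB) (gd ClassA) (gd ClassB).
by case: p; lra.
Qed.

Lemma wardrop_equilibrium_finite (d alpha : user_class -> R) (tau2 : R) f :
  feasible_flow d f -> (forall p, total_flow f p < c p) ->
  (forall i, 0 < f Net1 i ->
    (c Net1 - total_flow f Net1)^-1 - (c Net2 - total_flow f Net2)^-1
      <= alpha i * tau2) ->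
  (forall i, 0 < f Net2 i ->
    alpha i * tau2 <=
      (c Net1 - total_flow f Net1)^-1 - (c Net2 - total_flow f Net2)^-1) ->
  wardrop_equilibrium (delay c) d alpha (tax_on_net2 tau2) f.
Proof.
move=> fF fc f1 f2; split=> // p i fpi; rewrite /user_cost !delayE//.
rewrite -!EFinD lee_fin; case: p fpi => /= [/f1|/f2]; lra.
Qed.

(** * Convexity of the total delay *)

Hypothesis c0 : forall p, 0 < c p.

(* Each [x |-> x / (c p - x)] lies strictly above its tangent lines; the
   hypothesis is the first-order condition, using [h Net2 - g Net2 =
   - (h Net1 - g Net1)]. *)
Lemma total_delay_tangent (D : R) g h :
  feasible_totals D g -> feasible_totals D h -> (forall p, g p < c p) ->
  0 <= (c Net1 / (c Net1 - g Net1) ^+ 2 - c Net2 / (c Net2 - g Net2) ^+ 2)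
         * (h Net1 - g Net1) ->
  h Net1 != g Net1 ->
  (total_delay (delay c) g < total_delay (delay c) h)%E.
Proof.
move=> [g0 gD] [h0 hD] gc gh hg.
rewrite /total_delay !(delayE _ _ (gc _)) -!EFinM -EFinD.
(* Here [h p >= c p > 0], so the product is not of the form [0 * +oo]. *)
have inf p : ~~ (h p < c p) -> ((h p)%:E * delay c p (h p))%E = +oo%E.
  rewrite /delay => hc; rewrite (negbTE hc) gt0_muley// lte_fin.
  by rewrite -leNgt in hc; exact: lt_le_trans hc.
have noninf p : ((h p)%:E * delay c p (h p))%E != -oo%E.
  have [hc|] := boolP (h p < c p); first by rewrite (delayE _ _ hc) -EFinM.
  by move=> /inf ->.
have [h1|/inf ->] := boolP (h Net1 < c Net1); last by rewrite addye ?ltry.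
have [h2|/inf ->] := boolP (h Net2 < c Net2); last by rewrite addey ?ltry.
rewrite (delayE _ _ h1) (delayE _ _ h2) -!EFinM -EFinD lte_fin.
have tangent p : h p < c p ->
    h p / (c p - h p) - g p / (c p - g p) =
      c p / (c p - g p) ^+ 2 * (h p - g p)
      + c p * (h p - g p) ^+ 2 / ((c p - h p) * (c p - g p) ^+ 2).
  move=> hc; have gcp := gc p.
  by field; apply/andP; split; rewrite subr_eq0 gt_eqF.
have rem p : h p < c p -> h p != g p ->
    0 < c p * (h p - g p) ^+ 2 / ((c p - h p) * (c p - g p) ^+ 2).
  rewrite -(subr_eq0 (h p)) -subr_gt0 => hc hgp.
  have gcp : 0 < c p - g p by rewrite subr_gt0.
  apply: divr_gt0; apply: mulr_gt0 => //; last exact: exprn_gt0.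
  by rewrite exprn_even_gt0.
have hg2 : h Net2 != g Net2.
  by apply: contra_neq hg => hg2; move: gD hD; rewrite hg2; lra.
have hgD : h Net2 - g Net2 = - (h Net1 - g Net1) by lra.
move: (tangent _ h1) (tangent _ h2) (rem _ h1 hg) (rem _ h2 hg2).
rewrite {1}hgD mulrN; rewrite mulrBl in gh; lra.
Qed.

Lemma unique_min_total_delay (D : R) g :
  feasible_totals D g -> (forall p, g p < c p) ->
  (forall h, feasible_totals D h ->
    0 <= (c Net1 / (c Net1 - g Net1) ^+ 2 - c Net2 / (c Net2 - g Net2) ^+ 2)
           * (h Net1 - g Net1)) ->
  unique (min_total_delay (delay c) D) g.
Proof.
move=> gF gc gopt.
have eq1 h : feasible_totals D h -> h Net1 = g Net1 -> g = h.
  move=> [_ hD] hg; have [_ gD] := gF.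
  by apply/funext; case=> //; move: hD gD; rewrite hg; lra.
split=> [|h [hF hmin]].
  split=> // h hF; have [/(eq1 _ hF) ->//|hg] := eqVneq (h Net1) (g Net1).
  exact/ltW/(total_delay_tangent _ _ _ gF hF gc (gopt _ hF) hg).
have [/(eq1 _ hF)//|hg] := eqVneq (h Net1) (g Net1).
have := total_delay_tangent _ _ _ gF hF gc (gopt _ hF) hg.
by rewrite ltNge hmin.
Qed.

End Delay.

(** * The optimal split in closed form *)

Section Optimum.
Variables (R : realType) (c : network -> R) (D : R).
Hypotheses (c1_gt0 : 0 < c Net1) (c1_lt_c2 : c Net1 < c Net2).
Hypotheses (D_gt0 : 0 < D) (D_lt : D < c Net1 + c Net2).

Local Notation s := (Num.sqrt (c Net1 * c Net2)).
Local Notation K := (c Net2 + c Net1 - D).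

Lemma capacity_gt0 p : 0 < c p.
Proof. by case: p => //; exact: lt_trans c1_lt_c2. Qed.

Lemma sqr_sqrt_capacity : s ^+ 2 = c Net1 * c Net2.
Proof. by rewrite sqr_sqrtr// mulr_ge0 ?ltW ?capacity_gt0. Qed.

Lemma sqrt_capacity_bounds : c Net1 < s < c Net2.
Proof.
have c2_gt0 := capacity_gt0 Net2.
rewrite -ltr_sqr ?nnegrE ?sqrtr_ge0 ?ltW// -[X in _ && X]ltr_sqr.
- by rewrite sqr_sqrt_capacity !expr2 ltr_pM2l// ltr_pM2r// c1_lt_c2.
- by rewrite nnegrE sqrtr_ge0.
- by rewrite nnegrE ltW.
Qed.

(* Stationarity of the total delay makes the residual capacities [c p - f p]
   proportional to [Num.sqrt (c p)], i.e. to [c p / (c p + s)]. *)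
Definition interior_split p : R := c p - K * c p / (c p + s).

Definition corner_split p : R := if p is Net2 then D else 0.

Lemma capacity_sqrt_gt0 p : 0 < c p + s.
Proof. by rewrite ltr_wpDr ?sqrtr_ge0 ?capacity_gt0. Qed.

Lemma residual_gt0 : 0 < K.
Proof. by rewrite subr_gt0 addrC. Qed.

Lemma interior_splitE p : c p - interior_split p = K * c p / (c p + s).
Proof. by rewrite opprB addrC subrK. Qed.

Lemma interior_split_lt p : interior_split p < c p.
Proof.
rewrite -subr_gt0 interior_splitE divr_gt0 ?capacity_sqrt_gt0//.
by rewrite mulr_gt0 ?residual_gt0 ?capacity_gt0.
Qed.

Lemma interior_split_sum : interior_split Net1 + interior_split Net2 = D.
Proof.
suff : K * c Net1 / (c Net1 + s) + K * c Net2 / (c Net2 + s) = K.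
  by rewrite /interior_split; lra.
have ne p := lt0r_neq0 (capacity_sqrt_gt0 p).
have := ne Net1; have := ne Net2; have := sqr_sqrt_capacity.
move: (K) (s) => k t tE n2 n1; rewrite addf_div//.
apply: (canLR (mulfK _)); first by rewrite mulf_neq0.
apply/eqP; rewrite -subr_eq0; apply/eqP.
(* The defect is a multiple of [c Net1 * c Net2 - t ^+ 2], which vanishes at the square root. *)
transitivity (k * (c Net1 * c Net2 - t ^+ 2)); first by ring.
by rewrite tE subrr mulr0.
Qed.

(** Positivity amounts to [K < c p + s]: for [Net1] this is the hypothesis itself, for [Net2] the
    weaker [c Net1 - s < D]. *)
Lemma interior_split_gt0 p : c Net2 - s < D -> 0 < interior_split p.
Proof.
move=> Ds; have /andP[? ?] := sqrt_capacity_bounds; have ? := c1_gt0.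
rewrite subr_gt0 ltr_pdivrMr ?capacity_sqrt_gt0// mulrC ltr_pM2l ?capacity_gt0//.
by case: p; lra.
Qed.

Lemma interior_delay_diff :
  (c Net1 - interior_split Net1)^-1 - (c Net2 - interior_split Net2)^-1
    = (c Net2 - c Net1) / (s * K).
Proof.
have /andP[s1 _] := sqrt_capacity_bounds.
have s0 : s != 0 by rewrite gt_eqF// (lt_trans c1_gt0).
have k0 := lt0r_neq0 residual_gt0.
have c0 p := lt0r_neq0 (capacity_gt0 p).
rewrite !interior_splitE !invf_div.
have -> : (c Net1 + s) / (K * c Net1) - (c Net2 + s) / (K * c Net2)
    = s * (c Net2 - c Net1) / (K * (c Net1 * c Net2)).
  by move: (s) => t; field; rewrite k0 !c0.
move: (s) sqr_sqrt_capacity s0 => t <- t0.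
by field; rewrite t0 k0.
Qed.

Lemma interior_split_min : c Net2 - s < D ->
  unique (min_total_delay (delay c) D) interior_split.
Proof.
move=> Ds; apply: unique_min_total_delay.
- exact: capacity_gt0.
- by split; [move=> p; exact/ltW/interior_split_gt0|exact: interior_split_sum].
- exact: interior_split_lt.
move=> h _; rewrite !interior_splitE.
suff -> : c Net1 / (K * c Net1 / (c Net1 + s)) ^+ 2
    - c Net2 / (K * c Net2 / (c Net2 + s)) ^+ 2 = 0 by rewrite mul0r.
have k0 := lt0r_neq0 residual_gt0.
have c0 p := lt0r_neq0 (capacity_gt0 p).
have ne p := lt0r_neq0 (capacity_sqrt_gt0 p).
have := ne Net1; have := ne Net2; have := sqr_sqrt_capacity.
move: (s) => t tE n2 n1.
(* Equality of the marginal delays again reduces to [t ^+ 2 = c Net1 * c Net2]. *)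
transitivity ((c Net2 - c Net1) * (t ^+ 2 - c Net1 * c Net2)
                / (K ^+ 2 * (c Net1 * c Net2))); last first.
  by rewrite tE subrr mulr0 mul0r.
by field; rewrite k0 !c0 n1 n2.
Qed.

Lemma corner_split_lt : D <= c Net2 - s -> forall p, corner_split p < c p.
Proof.
move=> Ds p; have /andP[? ?] := sqrt_capacity_bounds; have ? := c1_gt0.
by case: p => /=; lra.
Qed.

(** At the corner only shifts towards [Net1] are possible; they do not pay when [c Net2 / (c Net2 -
    D) ^+ 2 <= (c Net1)^-1], that is, [s <= c Net2 - D]. *)
Lemma corner_split_min : D <= c Net2 - s ->
  unique (min_total_delay (delay c) D) corner_split.
Proof.
move=> Ds; apply: unique_min_total_delay.
- exact: capacity_gt0.
- by split; [case=> //=; exact: ltW|rewrite /= add0r].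
- exact: corner_split_lt.
move=> h [h0 _]; rewrite /= !subr0 mulr_ge0//.
have /andP[? ?] := sqrt_capacity_bounds; have ? := c1_gt0.
rewrite subr_ge0 ler_pdivrMr; last by rewrite exprn_gt0// subr_gt0; lra.
have -> : c Net1 / c Net1 ^+ 2 = (c Net1)^-1 by field; exact: lt0r_neq0.
rewrite ler_pdivlMl// -sqr_sqrt_capacity.
by rewrite ler_sqr ?nnegrE ?sqrtr_ge0//; lra.
Qed.

(** * Taxes inducing the optimum *)

Lemma interior_optimal_tax (d alpha : user_class -> R) :
  c Net2 - s < D -> D = d ClassA + d ClassB -> (forall i, 0 < d i) ->
  0 < alpha ClassB -> alpha ClassB < alpha ClassA ->
  optimal_tax (delay c) d alpha interior_split
    (if d ClassB <= interior_split Net2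
     then (c Net2 - c Net1) / (alpha ClassA * s * K)
     else (c Net2 - c Net1) / (alpha ClassB * s * K)).
Proof.
move=> Ds hD d0 aB aBA; have dA := d0 ClassA; have dB := d0 ClassB.
have ? := D_lt; have /andP[s1 _] := sqrt_capacity_bounds.
have T0 : 0 < (c Net2 - c Net1) / (s * K).
  by rewrite divr_gt0 ?mulr_gt0 ?subr_gt0 ?(lt_trans c1_gt0)//; lra.
(* Each tax is the delay gap divided by a sensitivity, so the class with that sensitivity is
   indifferent. *)
have taxE a : (c Net2 - c Net1) / (a * s * K)
    = a^-1 * ((c Net2 - c Net1) / (s * K)).
  by rewrite -mulrA (invfM a) mulrCA.
rewrite !taxE; move: interior_delay_diff T0; set T := _ / (s * K) => TE T0.
have F1 := interior_split_gt0 Net1 Ds; have F2 := interior_split_gt0 Net2 Ds.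
have FD := interior_split_sum.
have aA : 0 < alpha ClassA by exact: lt_trans aBA.
case: ifP => [dBle|/negbT]; last rewrite -ltNge => dBgt.
(* Class A splits; class B fits entirely on [Net2]. *)
- pose f p i := match p, i with
    | Net1, ClassA => interior_split Net1
    | Net1, ClassB => 0
    | Net2, ClassA => interior_split Net2 - d ClassB
    | Net2, ClassB => d ClassB end.
  have fE p : total_flow f p = interior_split p.
    by case: p; rewrite /total_flow /=; lra.
  apply: (@optimal_tax_of_equilibrium _ _ _ _ _ _ f) => //.
    exact: interior_split_lt.
  apply: wardrop_equilibrium_finite.
  + by split; [case; case|case] => /=; lra.
  + by move=> p; rewrite fE; exact: interior_split_lt.
  + by case; rewrite /= ?ltxx// !fE TE mulVKf ?gt_eqF.
  + case=> _; rewrite !fE TE; first by rewrite mulVKf ?gt_eqF.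
    (* Class B perceives [alpha ClassB / alpha ClassA < 1] times the gap, so it stays on [Net2]. *)
    by rewrite mulrA ler_piMl ?ltW// ltr_pdivrMr// mul1r.
(* Class B overflows [Net2] and splits; class A is entirely on [Net1], perceiving a tax above the
   gap. *)
- pose f p i := match p, i with
    | Net1, ClassA => d ClassA
    | Net1, ClassB => interior_split Net1 - d ClassA
    | Net2, ClassA => 0
    | Net2, ClassB => interior_split Net2 end.
  have fE p : total_flow f p = interior_split p.
    by case: p; rewrite /total_flow /=; lra.
  apply: (@optimal_tax_of_equilibrium _ _ _ _ _ _ f) => //.
    exact: interior_split_lt.
  apply: wardrop_equilibrium_finite.
  + by split; [case; case|case] => /=; lra.
  + by move=> p; rewrite fE; exact: interior_split_lt.
  + case=> _; rewrite !fE TE; last by rewrite mulVKf ?gt_eqF.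
    by rewrite mulrA ler_peMl ?ltW// ltr_pdivlMr// mul1r.
  + by case; rewrite /= ?ltxx// !fE TE mulVKf ?gt_eqF.
Qed.

Lemma corner_optimal_tax (d alpha : user_class -> R) :
  D <= c Net2 - s -> D = d ClassA + d ClassB -> (forall i, 0 < d i) ->
  optimal_tax (delay c) d alpha corner_split 0.
Proof.
move=> Ds hD d0; have /andP[? ?] := sqrt_capacity_bounds; have ? := c1_gt0.
pose f p i := if p is Net2 then d i else 0.
have fE p : total_flow f p = corner_split p.
  by case: p; rewrite /total_flow /= ?addr0.
apply: (@optimal_tax_of_equilibrium _ _ _ _ _ _ f) => //.
  exact: corner_split_lt.
apply: wardrop_equilibrium_finite.
- split=> [[] i|i] //=; last by rewrite add0r.
  exact: ltW.
- by move=> p; rewrite fE; exact: corner_split_lt.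
- by move=> i; rewrite /= ltxx.
(* Even carrying all users, [Net2] is faster than empty [Net1]: [c Net1 < s <= c Net2 - D]. *)
- move=> i _; rewrite !fE /= mulr0 subr0 subr_ge0.
  by rewrite lef_pV2 ?posrE ?subr_gt0//; lra.
Qed.

End Optimum.

Theorem proposition1 (R : realType) (c : network -> R)
    (d alpha : user_class -> R) (D : R)
    (hc1 : 0 < c Net1) (hc12 : c Net1 < c Net2)
    (hd : forall i, 0 < d i)
    (hD : D = d ClassA + d ClassB) (hDc : D < c Net1 + c Net2)
    (halphaB : 0 < alpha ClassB) (halphaAB : alpha ClassB < alpha ClassA) :
  (exists! g : network -> R, min_total_delay (delay c) D g) /\
  forall fopt : network -> R, min_total_delay (delay c) D fopt ->
    (c Net2 - Num.sqrt (c Net1 * c Net2) < D ->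
       optimal_tax (delay c) d alpha fopt
         (if d ClassB <= fopt Net2 then
            (c Net2 - c Net1) /
              (alpha ClassA * Num.sqrt (c Net1 * c Net2)
                 * (c Net2 + c Net1 - D))
          else
            (c Net2 - c Net1) /
              (alpha ClassB * Num.sqrt (c Net1 * c Net2)
                 * (c Net2 + c Net1 - D)))) /\
    (D <= c Net2 - Num.sqrt (c Net1 * c Net2) ->
       optimal_tax (delay c) d alpha fopt 0).
Proof.
have D0 : 0 < D by rewrite hD addr_gt0.
have [Ds|Ds] := ltP (c Net2 - Num.sqrt (c Net1 * c Net2)) D.
- have gmin := interior_split_min _ _ _ hc1 hc12 hDc Ds.
  split=> [|fopt /(gmin.2) <-]; first by exists (interior_split _ c D).
  split=> [_|//].
  exact: interior_optimal_tax.
- have gmin := corner_split_min _ _ _ hc1 hc12 D0 Ds.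
  split=> [|fopt /(gmin.2) <-]; first by exists (corner_split _ D).
  split=> [//|_].
  exact: corner_optimal_tax.
Qed.
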